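(* Let $Y,Z$ be distinct propositional variables. Then $(Y\vee Z)^*\nvdash_{\mathtt{NI}^{2\vee}_{at}}Y\vee Z$, where $(Y\vee Z)^*=\forall X.(Y\supset X)\supset((Z\supset X)\supset X)$ with $X$ distinct from $Y,Z$.
   Context: $\mathtt{NI}^{2\vee}_{at}$ is the natural deduction system for the formulas $A::=X\mid A\supset B\mid A\vee B\mid\forall X.A$ ($X$ ranging over propositional variables) with the standard intuitionistic introduction and elimination rules for $\supset$ and $\vee$, the rule $\forall$I (from $A$ infer $\forall X.A$, provided $X$ is not free in the undischarged assumptions), and the atomic elimination rule $\forall$E$_{at}$: from $\forall X.A$ infer $A\llbracket Y/X\rrbracket$, where the witness $Y$ must be a propositional variable. $\Gamma\vdash_{\mathtt{NI}^{2\vee}_{at}}A$ means that $A$ is derivable from assumptions $\Gamma$ in this system. $(\cdot)^*$ is the Russell–Prawitz translation. *)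

(* Defs.v *)
From Stdlib Require Import List Arith.
Import ListNotations.

(* Propositional variables are de Bruijn indices, so that syntactic equality is
   equality up to renaming of bound variables: [All A] binds index 0 of [A], and
   index n + 1 of [A] stands for the variable n of the surrounding context.
   The ambient stock of free propositional variables is therefore [nat]. *)
Inductive form : Type :=
| Var (n : nat)
| Imp (A B : form)
| Or (A B : form)
| All (A : form).

Definition up (f : nat -> nat) (n : nat) : nat :=
  match n with 0 => 0 | S m => S (f m) end.

Fixpoint ren (f : nat -> nat) (A : form) : form :=
  match A with
  | Var n => Var (f n)
  | Imp A B => Imp (ren f A) (ren f B)
  | Or A B => Or (ren f A) (ren f B)
  | All A => All (ren (up f) A)
  end.

Definition shift : form -> form := ren S.

(* The atomic instance A[Y/X] of [All A]. As witnesses are variables, renaming is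
   the only form of substitution that the calculus needs. *)
Definition inst (Y : nat) : form -> form :=
  ren (fun n => match n with 0 => Y | S m => m end).

(* In [NI_AllI], shifting the context makes 0 a variable that is not free in any
   undischarged assumption: this is the eigenvariable condition. The rules in
   terms of named variables are [NI_AllI_named] and [NI_AllE_named] below. *)
Inductive NI : list form -> form -> Prop :=
| NI_Ax G A : In A G -> NI G A
| NI_ImpI G A B : NI (A :: G) B -> NI G (Imp A B)
| NI_ImpE G A B : NI G (Imp A B) -> NI G A -> NI G B
| NI_OrI1 G A B : NI G A -> NI G (Or A B)
| NI_OrI2 G A B : NI G B -> NI G (Or A B)
| NI_OrE G A B C : NI G (Or A B) -> NI (A :: G) C -> NI (B :: G) C -> NI G C
| NI_AllI G A : NI (map shift G) A -> NI G (All A)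
| NI_AllE G A Y : NI G (All A) -> NI G (inst Y A).

(* Russell-Prawitz translation; in the disjunction clause the bound variable 0 is
   not free in the shifted translations of A and B. *)
Fixpoint star (A : form) : form :=
  match A with
  | Var n => Var n
  | Imp A B => Imp (star A) (star B)
  | Or A B =>
      All (Imp (Imp (shift (star A)) (Var 0))
               (Imp (Imp (shift (star B)) (Var 0)) (Var 0)))
  | All A => All (star A)
  end.

(* The quantification "forall X. A" over the free variable X of A. *)
Definition all_named (X : nat) (A : form) : form :=
  All (ren (fun n => if n =? X then 0 else S n) A).

Lemma star_Or_Var (X Y Z : nat) :
  X <> Y -> X <> Z ->
  star (Or (Var Y) (Var Z)) =
  all_named X (Imp (Imp (Var Y) (Var X)) (Imp (Imp (Var Z) (Var X)) (Var X))).
Proof.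
  intros HY HZ. unfold all_named. simpl. rewrite Nat.eqb_refl.
  apply not_eq_sym, Nat.eqb_neq in HY, HZ. now rewrite HY, HZ.
Qed.

Fixpoint free (X : nat) (A : form) : Prop :=
  match A with
  | Var n => n = X
  | Imp A B | Or A B => free X A \/ free X B
  | All A => free (S X) A
  end.

Lemma ren_ext_free (f g : nat -> nat) (A : form) :
  (forall n, free n A -> f n = g n) -> ren f A = ren g A.
Proof.
  revert f g. induction A as [n|A IA B IB|A IA B IB|A IA]; intros f g H; simpl in *.
  - now rewrite H.
  - rewrite (IA f g), (IB f g); auto.
  - rewrite (IA f g), (IB f g); auto.
  - rewrite (IA (up f) (up g)); auto. intros [|n] Hn; simpl; auto.
Qed.

Lemma ren_comp (f g : nat -> nat) (A : form) :
  ren f (ren g A) = ren (fun n => f (g n)) A.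
Proof.
  revert f g. induction A as [n|A IA B IB|A IA B IB|A IA]; intros f g; simpl;
    rewrite ?IA, ?IB; auto.
  f_equal. apply ren_ext_free. now intros [|n].
Qed.

Lemma NI_ren (f : nat -> nat) (G : list form) (A : form) :
  NI G A -> NI (map (ren f) G) (ren f A).
Proof.
  intros H. revert f. induction H; intros f; simpl in *.
  - apply NI_Ax, in_map, H.
  - apply NI_ImpI, IHNI.
  - eapply NI_ImpE; [apply IHNI1 | apply IHNI2].
  - apply NI_OrI1, IHNI.
  - apply NI_OrI2, IHNI.
  - eapply NI_OrE; [apply IHNI1 | apply IHNI2 | apply IHNI3].
  - apply NI_AllI. rewrite map_map. specialize (IHNI (up f)).
    rewrite map_map in IHNI. erewrite map_ext; [exact IHNI|].
    intros B. unfold shift. now rewrite !ren_comp.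
  - replace (ren f (inst Y A)) with (inst (f Y) (ren (up f) A)).
    + apply NI_AllE, IHNI.
    + unfold inst. rewrite !ren_comp. apply ren_ext_free. now intros [|n].
Qed.

Lemma NI_AllI_named (G : list form) (X : nat) (A : form) :
  (forall B, In B G -> ~ free X B) -> NI G A -> NI G (all_named X A).
Proof.
  intros HX H. apply NI_AllI.
  rewrite (map_ext_in shift (ren (fun n => if n =? X then 0 else S n))).
  - now apply NI_ren.
  - intros B HB. apply ren_ext_free. intros n Hn.
    destruct (Nat.eqb_spec n X) as [->|]; auto. now destruct (HX B HB).
Qed.

Lemma NI_AllE_named (G : list form) (X Y : nat) (A : form) :
  NI G (all_named X A) -> NI G (ren (fun n => if n =? X then Y else n) A).
Proof.
  intros H. apply (NI_AllE _ _ Y) in H. revert H. unfold inst. rewrite ren_comp.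
  erewrite ren_ext_free; [intros H; exact H|].
  intros n _. simpl. now destruct (n =? X).
Qed.

(* Main.v *)
Require Import Defs.
From Stdlib Require Import List Arith.
Import ListNotations.

(** The calculus is sound for Kripke models with a constant, possibly very small,
    domain [D] of truth values (upward closed sets of worlds): variables take
    values in [D] and [All] quantifies over [D] only. Closure of [D] under the
    connectives is not needed, since every witness of an elimination is a variable
    ([forces_sound]).

    The countermodel has a root below two incomparable worlds [a] and [b], and
    [D] consists of the two values {a} and {b}; interpret [Y] by {a} and [Z] by
    {b}. The root forces neither, hence not their disjunction. It does force the
    translation ([root_forces_translation]): the only instances to check are
    [X := Y] and [X := Z]. For [X := Y], a world above the root that forces
    [Z -> Y] cannot be the root or [b], because of [b]; it is therefore [a], where
    [Y] holds. The other instance is symmetric. *)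

(** Worlds: [None] is the root, [Some true] and [Some false] are the two
    incomparable worlds above it. *)
Definition world : Type := option bool.

Definition le (w v : world) : Prop := w = None \/ w = v.

Lemma le_refl (w : world) : le w w.
Proof. now right. Qed.

Lemma le_trans (u v w : world) : le u v -> le v w -> le u w.
Proof. intros [->| ->] H; [now left | exact H]. Qed.

(** Extension of a valuation by a value for the bound index 0. *)
Definition scons (d : bool) (rho : nat -> bool) (n : nat) : bool :=
  match n with 0 => d | S m => rho m end.

(** Kripke forcing. The boolean [d] stands for the truth value {Some d}, so that
    valuations are maps to [bool] and quantification is over [bool]. *)
Fixpoint forces (rho : nat -> bool) (A : form) (w : world) : Prop :=
  match A with
  | Var n => w = Some (rho n)
  | Imp A B => forall v, le w v -> forces rho A v -> forces rho B v
  | Or A B => forces rho A w \/ forces rho B w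
  | All A => forall d, forces (scons d rho) A w
  end.

Lemma forces_le (A : form) (rho : nat -> bool) (w v : world) :
  le w v -> forces rho A w -> forces rho A v.
Proof.
  revert rho. induction A as [n|A IA B IB|A IA B IB|A IA]; simpl; intros rho Hwv H.
  - destruct Hwv as [->| ->]; [discriminate H | exact H].
  - intros u Hvu. apply H. now apply (le_trans w v u).
  - destruct H; [left | right]; auto.
  - auto.
Qed.

Lemma forces_ren (A : form) (f : nat -> nat) (rho rho' : nat -> bool) (w : world) :
  (forall n, rho (f n) = rho' n) -> forces rho (ren f A) w <-> forces rho' A w.
Proof.
  revert f rho rho' w.
  induction A as [n|A IA B IB|A IA B IB|A IA]; simpl; intros f rho rho' w H.
  - now rewrite H.
  - split; intros K v Hv HA;
      apply (IB f rho rho' v H), K, (IA f rho rho' v H); assumption.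
  - now rewrite (IA f rho rho'), (IB f rho rho').
  - split; intros K d; apply (IA (up f) (scons d rho) (scons d rho'));
      try apply K; intros [|n]; simpl; auto.
Qed.

Lemma forces_sound (G : list form) (A : form) :
  NI G A ->
  forall rho w, (forall B, In B G -> forces rho B w) -> forces rho A w.
Proof.
  intros H.
  induction H as [G A HA|G A B _ IH|G A B _ IH1 _ IH2|G A B _ IH|G A B _ IH
                 |G A B C _ IH _ IHA _ IHB|G A _ IH|G A Y _ IH];
    intros rho w HG; simpl in *.
  - auto.
  - intros v Hv HA. apply IH. intros C [<-|HC]; [exact HA|].
    apply (forces_le C rho w v Hv); auto.
  - apply (IH1 rho w HG w (le_refl w)). now apply IH2.
  - left. auto.
  - right. auto.
  - destruct (IH rho w HG) as [HA|HB]; [apply IHA | apply IHB];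
      intros D [<-|HD]; auto.
  - intros d. apply IH. intros B HB. apply in_map_iff in HB as [C [<- HC]].
    apply (forces_ren C S (scons d rho) rho); auto.
  - (* The witness takes its value [rho Y] in the domain of quantification. *)
    unfold inst. apply (forces_ren A _ rho (scons (rho Y) rho)).
    + now intros [|n].
    + now apply IH.
Qed.

Lemma root_forces_translation (rho : nat -> bool) (Y Z : nat) :
  rho Y = true -> rho Z = false ->
  forces rho (star (Or (Var Y) (Var Z))) None.
Proof.
  intros HY HZ. simpl. rewrite HY, HZ. intros d v _ HYd u Hvu HZd.
  destruct d.
  - (* [X := Y]: if [u] lies below [Some false], then [Z -> Y] fails at [u]. *)
    destruct u as [[|]|]; [reflexivity| |];
      discriminate (HZd (Some false) ltac:(first [now left | now right]) eq_refl).
  - (* [X := Z]: if [u] lies below [Some true], then so does [v], and [Y -> Z]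
       fails at [v]. *)
    destruct u as [[|]|]; [|reflexivity|];
      discriminate (HYd (Some true)
                        (le_trans _ _ _ Hvu ltac:(first [now left | now right])) eq_refl).
Qed.

Theorem proposition6 (Y Z : nat) (hYZ : Y <> Z) :
  ~ NI [star (Or (Var Y) (Var Z))] (Or (Var Y) (Var Z)).
Proof.
  intros H. set (rho := fun n => n =? Y).
  assert (HY : rho Y = true) by apply Nat.eqb_refl.
  assert (HZ : rho Z = false) by now apply Nat.eqb_neq, not_eq_sym.
  destruct (forces_sound _ _ H rho None) as [K|K]; try discriminate K.
  intros B [<-|[]]. now apply root_forces_translation.
Qed.
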